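(* Let $N_1<N_2<\cdots$ be natural numbers, $\mathbf{N}=([N_s])_{s\in\mathbb{N}}$, and let $\mathcal{A}\subset\ell^\infty(\mathbb{Z})$ be a translation invariant $C^*$-subalgebra that admits logarithmic averages along $\mathbf{N}$. Let $f\in\mathcal{A}$ with spectral measure $\mu_f$. Then: (i) if $f$ is locally quasiperiodic, then $\mu_f$ is supported on the rational points of $\mathbb{T}$ (the set of rationals in $[0,1)$ has full $\mu_f$-measure); (ii) if $f$ is locally aperiodic, then $\mu_f$ is supported on the irrational points of $\mathbb{T}$.
   Context: $\mathbb{T}=\mathbb{R}/\mathbb{Z}$ is identified with $[0,1)$; $e(x)=e^{2\pi ix}$; $[N]=\{1,\dots,N\}$; for finite nonempty $B\subset\mathbb{N}$, $\mathbb{E}^{\log}_{n\in B}f(n)=\big(\sum_{n\in B}f(n)/n\big)/\big(\sum_{n\in B}1/n\big)$; $\mathbb{E}_{h\in[H]}$ is the uniform average. $\ell^\infty(\mathbb{Z})$ is the space of bounded functions $\mathbb{Z}\to\mathbb{C}$; a $C^*$-subalgebra is a sup-norm-closed subset containing $1_{\mathbb{Z}}$ closed under linear combinations, products and complex conjugation; translation invariant: $n\mapsto f(n+b)$ is in $\mathcal{A}$ for $f\in\mathcal{A}$, $b\in\mathbb{Z}$. $\mathcal{A}$ admits logarithmic averages along $\mathbf{N}$ if $\mathbb{E}^{\log}_{n\in\mathbf{N}}f(n):=\lim_{s\to\infty}\mathbb{E}^{\log}_{n\in[N_s]}f(n)$ exists for all $f\in\mathcal{A}$. The spectral measure $\mu_f$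 is the finite Borel measure on $\mathbb{T}$ with $\mathbb{E}^{\log}_{n\in\mathbf{N}}f(n)\overline{f(n+m)}=\int_{\mathbb{T}}e(mx)\,d\mu_f(x)$ for all $m\in\mathbb{Z}$ (exists by Herglotz's theorem). $f$ is locally aperiodic if for all $q\in\mathbb{Z}\setminus\{0\}$, $\lim_{H\to\infty}\mathbb{E}^{\log}_{n\in\mathbf{N}}|\mathbb{E}_{h\in[H]}f(n+qh)|^2=0$; locally quasiperiodic if for every $\epsilon>0$ there is $q\in\mathbb{N}$ with $\sup_{m\in\mathbb{N}}\mathbb{E}^{\log}_{n\in\mathbf{N}}|f(n+qm)-f(n)|^2\le\epsilon$. *)

(* Defs.v *)
From HB Require Import structures.
From mathcomp Require Import all_boot all_order all_algebra.
From mathcomp Require Import complex.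
From mathcomp Require Import all_classical all_reals all_analysis.
Set Implicit Arguments.
Unset Strict Implicit.
Unset Printing Implicit Defensive.
Import Order.TTheory GRing.Theory Num.Theory.
Import numFieldNormedType.Exports.
Local Open Scope classical_set_scope.
Local Open Scope complex_scope.
Local Open Scope ring_scope.

(* The complex numbers are [R[i]], for an arbitrary [R : realType].  The modulus
   of [R[i]] as a numFieldType is [R[i]]-valued; [cmod] is the [R]-valued one. *)
Definition cmod (R : realType) (z : R[i]) : R := ComplexField.Normc.normc z.

Definition linfty (R : realType) : set (int -> R[i]) :=
  [set f | exists M : R, forall n, cmod (f n) <= M].

Arguments linfty : clear implicits.

(* Only meaningful on [linfty]: [sup] of an unbounded set of reals is 0. *)
Definition supnorm (R : realType) (f : int -> R[i]) : R :=
  sup (range (fun n => cmod (f n))).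

Record cstar_subalgebra (R : realType) (A : set (int -> R[i])) : Prop := {
  cstar_linfty : A `<=` linfty R ;
  cstar_closed : forall f, linfty R f ->
    (forall e : R, 0 < e ->
       exists2 g, A g & supnorm (fun n => f n - g n) < e) -> A f ;
  cstar_one : A (fun=> 1) ;
  cstar_lin : forall (a b : R[i]) f g,
    A f -> A g -> A (fun n => a * f n + b * g n) ;
  cstar_mul : forall f g, A f -> A g -> A (fun n => f n * g n) ;
  cstar_conj : forall f, A f -> A (fun n => (f n)^*%C) }.

Definition translation_invariant (R : realType) (A : set (int -> R[i])) :=
  forall f (b : int), A f -> A (fun n => f (n + b)).

Section averages.
Variable K : numFieldType.

(* logarithmic average over {1, ..., N} *)
Definition logavg (N : nat) (f : int -> K) : K :=
  (\sum_(1 <= n < N.+1) f n%:Z / n%:R) / (\sum_(1 <= n < N.+1) n%:R^-1).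

(* uniform average over {1, ..., H} *)
Definition unifavg (H : nat) (f : nat -> K) : K :=
  (\sum_(1 <= h < H.+1) f h) / H%:R.

Definition has_logmean (N : nat -> nat) (f : int -> K) : Prop :=
  cvgn (fun s => logavg (N s) f).

(* Only meaningful when [has_logmean N f]. *)
Definition logmean (N : nat -> nat) (f : int -> K) : K :=
  limn (fun s => logavg (N s) f).

End averages.

Definition admits_logmeans (R : realType) (N : nat -> nat)
    (A : set (int -> R[i])) :=
  forall f, A f -> has_logmean N f.

Definition locally_aperiodic (R : realType) (N : nat -> nat)
    (f : int -> R[i]) :=
  forall q : int, q != 0 ->
    (fun H : nat => logmean N
       (fun n => cmod (unifavg H (fun h => f (n + q * h%:Z))) ^+ 2))
      @ \oo --> (0 : R).

Definition locally_quasiperiodic (R : realType) (N : nat -> nat)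
    (f : int -> R[i]) :=
  forall e : R, 0 < e -> exists2 q : nat, (0 < q)%N &
    (ereal_sup [set (logmean N
         (fun n => cmod (f (n + (q * m)%N%:Z) - f n) ^+ 2))%:E
       | m in [set m : nat | (0 < m)%N]] <= e%:E)%E.

Section torus.
Variable R : realType.

(* e(x) = exp(2 i pi x) *)
Definition expi2pi (x : R) : R[i] := cos (2 * pi * x) +i* sin (2 * pi * x).

Definition complex_integral
    (mu : {measure set (measurableTypeR R) -> \bar R})
    (D : set R) (F : R -> R[i]) : R[i] :=
  Rintegral mu D (fun x => complex.Re (F x))
  +i* Rintegral mu D (fun x => complex.Im (F x)).

(* The circle R/Z is identified with [0, 1): a finite Borel measure on it is a
   finite Borel measure on R that gives no mass to the complement of [0, 1). *)
Definition on_torus (mu : {finite_measure set (measurableTypeR R) -> \bar R}) :=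
  mu (~` `[0, 1[%classic) = 0%E.

Definition spectral_measure (N : nat -> nat) (f : int -> R[i])
    (mu : {finite_measure set (measurableTypeR R) -> \bar R}) :=
  on_torus mu /\
  forall m : int,
    logmean N (fun n => f n * (f (n + m))^*%C) =
    complex_integral mu `[0, 1[%classic (fun x => expi2pi (m%:~R * x)).

(* [mu] is supported on [S], in the sense that [S] has full measure. *)
Definition supported_on
    (mu : {finite_measure set (measurableTypeR R) -> \bar R}) (S : set R) :=
  mu (`[0, 1[%classic `\` S) = 0%E.

End torus.

(* Main.v *)
Require Import Defs.
From mathcomp Require Import all_boot all_order all_algebra.
From mathcomp Require Import complex.
From mathcomp Require Import all_classical all_reals all_analysis.
From mathcomp Require Import ring lra.
Import Order.TTheory GRing.Theory Num.Theory.
Import numFieldNormedType.Exports.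
Local Open Scope classical_set_scope.
Local Open Scope complex_scope.
Local Open Scope ring_scope.

(** Logarithmic averages are asymptotically shift invariant, so for real
    weights [a] and shifts [p] the logarithmic mean of
    [|sum_i a_i f(n + p_i)|^2] is the [mu]-integral of
    [|sum_i a_i e(p_i x)|^2].

    (i) Quasiperiodicity bounds the integral of [|e(q m x) - 1|^2] by [eps],
    uniformly in [m].  Averaged over [m], the integrand tends to 2 at every
    irrational [x], so the irrationals have measure at most [eps].

    (ii) If [q x] is an integer, then [|E_(h in [H]) e(q h x)|^2 = 1], so the
    mass of [x] is at most the integral of this function, which tends to 0 by
    aperiodicity.  The rationals are countable. *)

(** * Linearity and real parts of logarithmic averages *)

Lemma eq_logavg (K : numFieldType) M (f g : int -> K) :
  f =1 g -> logavg M f = logavg M g.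
Proof. by move=> /funext ->. Qed.

Lemma logavg_sum (K : numFieldType) M (I : Type) (r : seq I) (a : I -> K)
    (g : I -> int -> K) :
  logavg M (fun n => \sum_(i <- r) a i * g i n) =
  \sum_(i <- r) a i * logavg M (g i).
Proof.
rewrite /logavg; under eq_bigr do rewrite mulr_suml.
rewrite exchange_big mulr_suml; apply: eq_bigr => i _.
rewrite mulrA; congr (_ / _); rewrite mulr_sumr.
by apply: eq_bigr => n _; rewrite mulrA.
Qed.

Lemma ReD (R : realType) (z w : R[i]) :
  complex.Re (z + w) = complex.Re z + complex.Re w.
Proof. by case: z w => [a b] [c d]. Qed.

Lemma ReB (R : realType) (z w : R[i]) :
  complex.Re (z - w) = complex.Re z - complex.Re w.
Proof. by case: z w => [a b] [c d]. Qed.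

(** The weights [1/n] are real. This turns the complex spectral identity into a real one, to which
    the order-based shift estimate applies. *)
Lemma Re_logavg (R : realType) M (f : int -> R[i]) :
  complex.Re (logavg M f) = logavg M (fun n => complex.Re (f n)).
Proof.
have inv_natC n : (n%:R : R[i])^-1 = real_complex R n%:R^-1 by rewrite fmorphV rmorph_nat.
have ReMr (z : R[i]) (r : R) : complex.Re (z * real_complex R r) = complex.Re z * r.
  by case: z => a b /=; rewrite mulr0 subr0.
rewrite /logavg; under [X in _ / X]eq_bigr do rewrite inv_natC.
have <- : real_complex R (\sum_(1 <= n < M.+1) n%:R^-1) =
    \sum_(1 <= n < M.+1) real_complex R n%:R^-1 by rewrite rmorph_sum.
have -> (r : R) : (real_complex R r)^-1 = real_complex R r^-1.
  by rewrite fmorphV.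
rewrite ReMr; congr (_ / _).
rewrite (big_morph (@complex.Re R) (@ReD R) (erefl : complex.Re 0 = 0)).
by apply: eq_bigr => n _; rewrite inv_natC ReMr.
Qed.

Lemma cvg_Re (R : realType) (u : nat -> (R[i] : numFieldType))
    (l : (R[i] : numFieldType)) :
  u @ \oo --> l -> (fun s => complex.Re (u s)) @ \oo --> complex.Re l.
Proof.
move=> /cvgrPdist_lt ul; apply/cvgrPdist_lt => e e0.
have /ul : 0 < e%:C by rewrite ltcR.
apply: filterS => s; rewrite -ReB => le_e.
by rewrite -ltcR; apply: le_lt_trans le_e; exact: normc_ge_Re.
Qed.

(** * Asymptotic shift invariance of logarithmic averages *)

Definition harmonic_sum (R : realType) M : R := \sum_(1 <= n < M.+1) n%:R^-1.

(** Strict monotonicity forces [s <= N s], so divergence of the harmonic series passes to the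
    subsequence. *)
Lemma cvg_harmonic_sum (R : realType) (N : nat -> nat)
    (N_incr : forall s t, (s < t)%N -> (N s < N t)%N) :
  (fun s => harmonic_sum R (N s)) @ \oo --> +oo.
Proof.
have hE : @harmonic_sum R = series harmonic.
  by apply/funext => M; rewrite /harmonic_sum big_add1.
have N_ge s : (s <= N s)%N.
  by elim: s => // s IH; apply: leq_ltn_trans IH (N_incr _ _ _).
have : harmonic_sum R @ \oo --> +oo.
  rewrite hE; apply: nondecreasing_dvgn_lt; last exact: dvg_harmonic.
  apply/nondecreasing_seqP => n.
  by rewrite -subr_ge0 seriesSB harmonic_ge0.
move=> h; apply: cvg_comp h; apply/cvgnyPge => A.
exists A => // s /= As; exact: leq_trans As (N_ge s).
Qed.

(** Summation by parts: shifting [g] by one amounts to shifting the weights [1/n], up to two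
    boundary terms. These cost at most [2 * K], and the total variation of the decreasing weights
    costs at most [K]. *)
Lemma logavg_shift1_le (R : realType) M (g : int -> R) K :
  (forall n, `|g n| <= K) ->
  `|logavg M (fun n => g (n + 1)) - logavg M g| <= 3 * K / harmonic_sum R M.
Proof.
move=> gK; rewrite /logavg -mulrBl normrM.
have K0 : 0 <= K := le_trans (normr_ge0 _) (gK 0).
rewrite [X in _ * X]ger0_norm; last first.
  by rewrite invr_ge0 sumr_ge0// => n _; rewrite invr_ge0.
apply: ler_wpM2r.
  by rewrite invr_ge0 sumr_ge0// => n _; rewrite invr_ge0.
pose w n : R := n%:R^-1.
have w_ge0 n : 0 <= w n by rewrite invr_ge0.
(* At [n = 0] the inverse is 0 by convention. *)
have w_le1 n : w n <= 1.
  by case: n => [|n]; rewrite /w ?invr0// invf_le1// ler1n.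
have -> : \sum_(1 <= n < M.+1) g (n%:Z + 1) / n%:R
    - \sum_(1 <= n < M.+1) g n%:Z / n%:R
  = \sum_(1 <= n < M.+1) (g n.+1%:Z * w n.+1 - g n%:Z * w n)
    + \sum_(1 <= n < M.+1) g n.+1%:Z * (w n - w n.+1).
  rewrite -sumrB -big_split /=; apply: eq_bigr => n _.
  by rewrite -PoszD addn1 /w; ring.
have bd n : `|g n%:Z * w n| <= K.
  by rewrite normrM (ger0_norm (w_ge0 n)) -[leRHS]mulr1 ler_pM.
rewrite telescope_sumr//.
have -> : 3 * K = K + K + K by ring.
apply: le_trans (ler_normD _ _) _; apply: lerD.
  exact: le_trans (ler_normB _ _) (lerD (bd _) (bd _)).
apply: le_trans (ler_norm_sum _ _ _) _.
(* The majorant [K * (w n - w n.+1)] is written as an increment of [- K * w] so that it telescopes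
   to [K * (w 1 - w M.+1) <= K]. *)
apply: (@le_trans _ _ (\sum_(1 <= n < M.+1) (- K * w n.+1 - - K * w n))).
  apply: ler_sum_nat => n /andP[n1 _]; rewrite normrM.
  have ww : w n.+1 <= w n.
    by rewrite lef_pV2 ?posrE ?ltr0n// ler_nat.
  rewrite (@ger0_norm _ (w n - _)) ?subr_ge0//.
  have -> : - K * w n.+1 - - K * w n = K * (w n - w n.+1) by ring.
  by rewrite ler_wpM2r ?subr_ge0.
rewrite telescope_sumr//.
have -> : w 1%N = 1 by exact: invr1.
have := mulr_ge0 K0 (w_ge0 M.+1).
by rewrite mulr1 opprK mulNr addrC gerBl.
Qed.

(** By induction on [p]: each unit shift changes the average by at most [3 * K / harmonic_sum],
    which tends to 0. *)
Lemma cvg_logavg_shift (R : realType) (N : nat -> nat) (g : int -> R)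
    (K l : R) (p : nat) :
  (forall s t, (s < t)%N -> (N s < N t)%N) -> (forall n, `|g n| <= K) ->
  (fun s => logavg (N s) g) @ \oo --> l ->
  (fun s => logavg (N s) (fun n => g (n + p%:Z))) @ \oo --> l.
Proof.
move=> N_incr gK gl; elim: p => [|p IH].
  have -> : (fun n => g (n + 0%:Z)) = g by apply/funext => n; rewrite addr0.
  exact: gl.
pose h n := g (n + p%:Z).
have -> : (fun n => g (n + p.+1%:Z)) = (fun n => h (n + 1)).
  by apply/funext => n; rewrite /h -addrA -PoszD add1n.
have -> : (fun s => logavg (N s) (fun n => h (n + 1))) =
  (fun s => (logavg (N s) (fun n => h (n + 1)) - logavg (N s) h)
     + logavg (N s) h) by apply/funext => s; rewrite subrK.
have H0 : (fun s => 3 * K / harmonic_sum R (N s)) @ \oo --> (0 : R).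
  rewrite -(mulr0 (3 * K)); apply: cvgMl_tmp.
  have hy := cvg_harmonic_sum R _ N_incr.
  by apply/gtr0_cvgV0 => //; move/cvgryPgt: hy => /(_ 0).
rewrite -[l]add0r; apply: cvgD => //.
apply: (@squeeze_cvgr _ _ _ _ (fun s => - (3 * K / harmonic_sum R (N s)))
    (fun s => 3 * K / harmonic_sum R (N s))) => //.
- near=> s; rewrite -ler_norml; apply: logavg_shift1_le => n; exact: gK.
- by rewrite -oppr0; apply: cvgN.
Unshelve. all: by end_near.
Qed.

(** * Squared moduli of linear combinations, and integrals of trigonometric sums *)

Lemma sqr_cmod (R : realType) (z : R[i]) :
  cmod z ^+ 2 = complex.Re z ^+ 2 + complex.Im z ^+ 2.
Proof. by case: z => a b; rewrite /cmod /= sqr_sqrtr// addr_ge0 ?sqr_ge0. Qed.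

Lemma normr_Re_le_cmod (R : realType) (z : R[i]) : `|complex.Re z| <= cmod z.
Proof.
have c0 : 0 <= cmod z by case: z => a b; exact: sqrtr_ge0.
by rewrite -ler_sqr ?nnegrE// sqr_cmod real_normK ?num_real// lerDl sqr_ge0.
Qed.

Lemma Re_mul_conj (R : realType) (z w : R[i]) :
  complex.Re (z * w^*%C) =
  complex.Re z * complex.Re w + complex.Im z * complex.Im w.
Proof. by case: z w => [a b] [c d] /=; rewrite mulrN opprK. Qed.

Lemma sum_sqrD (R : comNzRingType) (I : Type) (r : seq I) (a u v : I -> R) :
  (\sum_(i <- r) a i * u i) ^+ 2 + (\sum_(i <- r) a i * v i) ^+ 2 =
  \sum_(i <- r) a i * \sum_(j <- r) a j * (u i * u j + v i * v j).
Proof.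
rewrite !expr2 !mulr_suml -big_split; apply: eq_bigr => i _ /=.
rewrite !mulr_sumr -big_split; apply: eq_bigr => j _ /=; ring.
Qed.

(** Since the coefficients are real, only real parts of the correlations survive in the expanded
    square. *)
Lemma sqr_cmod_sum (R : realType) (I : Type) (r : seq I) (a : I -> R)
    (z : I -> R[i]) :
  cmod (\sum_(i <- r) real_complex R (a i) * z i) ^+ 2 =
  \sum_(i <- r) a i * \sum_(j <- r) a j * complex.Re (z i * (z j)^*%C).
Proof.
under [RHS]eq_bigr do under eq_bigr do rewrite Re_mul_conj.
rewrite -sum_sqrD sqr_cmod.
suff -> : \sum_(i <- r) real_complex R (a i) * z i =
    (\sum_(i <- r) a i * complex.Re (z i))
    +i* (\sum_(i <- r) a i * complex.Im (z i)) by [].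
elim/big_rec3: _ => // i x y s _ ->.
by case: (z i) => c d; apply/eqP; rewrite eq_complex /=; apply/andP;
  split; apply/eqP; ring.
Qed.

Lemma cvg_sumZ (R : realType) (I : Type) (r : seq I) (a : I -> R)
    (u : I -> nat -> R) (l : I -> R) :
  (forall i, u i @ \oo --> l i) ->
  (fun s => \sum_(i <- r) a i * u i s) @ \oo --> \sum_(i <- r) a i * l i.
Proof.
move=> ul; elim: r => [|i r IH].
  rewrite big_nil; under eq_cvg do rewrite big_nil; exact: cvg_cst.
rewrite big_cons; under eq_cvg do rewrite big_cons.
by apply: cvgD => //; apply: cvgMl_tmp.
Qed.

Lemma integrable_sumZ d (T : measurableType d) (R : realType)
    (mu : {finite_measure set T -> \bar R}) (D : set T) (I : Type)
    (r : seq I) (a : I -> R) (g : I -> T -> R) :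
  measurable D -> (forall i, mu.-integrable D (EFin \o g i)) ->
  mu.-integrable D (EFin \o (fun x => \sum_(i <- r) a i * g i x)).
Proof.
move=> mD ig; have : mu.-integrable D
    (fun x => \sum_(i <- r) ((a i)%:E * (g i x)%:E)%E).
  apply: (@integrable_sum _ _ _ _ _ mD _ r predT
    (fun i x => ((a i)%:E * (g i x)%:E)%E)) => i _.
  exact: (@integrableZl _ _ _ mu D mD (a i) _ (ig i)).
by apply: eq_integrable => // x _; rewrite /= -sumEFin.
Qed.

Lemma Rintegral_sumZ d (T : measurableType d) (R : realType)
    (mu : {finite_measure set T -> \bar R}) (D : set T) (I : Type)
    (r : seq I) (a : I -> R) (g : I -> T -> R) :
  measurable D -> (forall i, mu.-integrable D (EFin \o g i)) ->
  Rintegral mu D (fun x => \sum_(i <- r) a i * g i x) =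
  \sum_(i <- r) a i * Rintegral mu D (g i).
Proof.
move=> mD ig; elim: r => [|i r IH].
  rewrite big_nil; under eq_Rintegral do rewrite big_nil.
  by rewrite Rintegral_cst// mul0r.
rewrite big_cons -IH -RintegralZl// -RintegralD//.
- by apply: eq_Rintegral => x _; rewrite big_cons.
- exact: (@integrableZl _ _ _ mu D mD (a i) _ (ig i)).
- exact: integrable_sumZ.
Qed.

Lemma integrable_cos (R : realType)
    (mu : {finite_measure set (measurableTypeR R) -> \bar R}) (D : set R)
    (c : R) :
  measurable D ->
  mu.-integrable D (EFin \o (fun x => cos (2 * pi * (c * x)))).
Proof.
move=> mD; apply: (@measurable_bounded_integrable _ _ _ mu) => //.
- by rewrite ltey_eq fin_num_measure.
- apply: (@measurable_funTS _ _ (measurableTypeR R) R).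
  apply: measurable_realfun.continuous_measurable_fun => x.
  apply: continuous_comp; last exact: continuous_cos.
  by apply: cvgMl_tmp; apply: cvgMl_tmp; exact: cvg_id.
- exists 1; split; first exact: num_real.
  by move=> M M1 x _ /=; apply: le_trans (cos_max _) (ltW M1).
Qed.

(** The integrand is [cos (2 * pi * ((c - b) * x))], kept in the product form that [sum_sqrD]
    produces. *)
Lemma integrable_cosB (R : realType)
    (mu : {finite_measure set (measurableTypeR R) -> \bar R}) (D : set R)
    (b c : R) :
  measurable D ->
  mu.-integrable D (EFin \o (fun x =>
    cos (2 * pi * (b * x)) * cos (2 * pi * (c * x)) +
    sin (2 * pi * (b * x)) * sin (2 * pi * (c * x)))).
Proof.
move=> mD; rewrite (_ : (fun x : R => _) = fun x => cos (2 * pi * ((c - b) * x))).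
  exact: integrable_cos.
apply/funext => x.
have -> : 2 * pi * ((c - b) * x) = 2 * pi * (c * x) + - (2 * pi * (b * x)).
  by ring.
by rewrite cosD cosN sinN; ring.
Qed.

(** * From correlations to integrals against the spectral measure *)

Lemma cvg_logavg_corr (R : realType) (N : nat -> nat)
    (N_incr : forall s t, (s < t)%N -> (N s < N t)%N)
    (A : set (int -> R[i])) (A_cstar : cstar_subalgebra A)
    (A_trans : translation_invariant A) (A_logmeans : admits_logmeans N A)
    (f : int -> R[i]) (Af : A f)
    (mu : {finite_measure set (measurableTypeR R) -> \bar R})
    (mu_spectral : spectral_measure N f mu) (p q : nat) :
  (fun s => logavg (N s) (fun n =>
     complex.Re (f (n + p%:Z) * (f (n + q%:Z))^*%C))) @ \oo -->
  Rintegral mu `[0, 1[%classic (fun x =>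
    cos (2 * pi * (p%:R * x)) * cos (2 * pi * (q%:R * x)) +
    sin (2 * pi * (p%:R * x)) * sin (2 * pi * (q%:R * x))).
Proof.
(* The product of the shifts by [p] and [q] is the lag-[m] correlation shifted by [p]. Shift
   invariance removes [p], and the real part of the spectral identity at [m] gives the integral of
   [cos (2 * pi * (m%:~R * x))]. *)
pose m : int := q%:Z - p%:Z.
pose corr n := f n * (f (n + m))^*%C.
have Acorr : A corr.
  by apply: cstar_mul => //; apply: cstar_conj => //; apply: A_trans.
have [K corrK] := cstar_linfty A_cstar Acorr.
have limE : logmean N corr = _ := mu_spectral.2 m.
have Nl := A_logmeans _ Acorr.
move/cvg_Re : Nl; under eq_cvg do rewrite Re_logavg.
rewrite -/(logmean N corr) limE /= => corr_cvg.
have := @cvg_logavg_shift R N _ K _ p N_incr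
  (fun n => le_trans (normr_Re_le_cmod _ _) (corrK n)) corr_cvg.
have -> : (fun s => logavg (N s) (fun n => complex.Re (corr (n + p%:Z)))) =
    (fun s => logavg (N s) (fun n =>
       complex.Re (f (n + p%:Z) * (f (n + q%:Z))^*%C))).
  apply/funext => s; congr logavg; apply/funext => n.
  by rewrite /corr /m; congr (complex.Re (_ * (f _)^*%C)); ring.
suff -> : (fun x => cos (2 * pi * (m%:~R * x))) = (fun x : R =>
    cos (2 * pi * (p%:R * x)) * cos (2 * pi * (q%:R * x)) +
    sin (2 * pi * (p%:R * x)) * sin (2 * pi * (q%:R * x))) by [].
apply/funext => x; rewrite /m intrB -!pmulrn.
have -> : 2 * pi * ((q%:R - p%:R) * x) =
  2 * pi * (q%:R * x) + - (2 * pi * (p%:R * x)) :> R by ring.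
by rewrite cosD cosN sinN; ring.
Qed.

(* |sum_i a_i e(p_i x)|^2 *)
Definition sqnorm_expsum (R : realType) (I : Type) (r : seq I) (a : I -> R)
    (p : I -> nat) (x : R) : R :=
  (\sum_(i <- r) a i * cos (2 * pi * ((p i)%:R * x))) ^+ 2 +
  (\sum_(i <- r) a i * sin (2 * pi * ((p i)%:R * x))) ^+ 2.
Arguments sqnorm_expsum {R I} r a p x.

Lemma sqnorm_expsum_ge0 (R : realType) (I : Type) (r : seq I) (a : I -> R)
    (p : I -> nat) (x : R) : 0 <= sqnorm_expsum r a p x.
Proof. by rewrite addr_ge0 ?sqr_ge0. Qed.

Lemma integrable_sqnorm_expsum (R : realType)
    (mu : {finite_measure set (measurableTypeR R) -> \bar R}) (D : set R)
    (I : Type) (r : seq I) (a : I -> R) (p : I -> nat) :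
  measurable D -> mu.-integrable D (EFin \o sqnorm_expsum r a p).
Proof.
move=> mD.
pose g i j (x : R) :=
  cos (2 * pi * ((p i)%:R * x)) * cos (2 * pi * ((p j)%:R * x)) +
  sin (2 * pi * ((p i)%:R * x)) * sin (2 * pi * ((p j)%:R * x)).
have -> : sqnorm_expsum r a p =
    (fun x => \sum_(i <- r) a i * \sum_(j <- r) a j * g i j x).
  by apply/funext => x; exact: sum_sqrD.
apply: integrable_sumZ => // i; apply: integrable_sumZ => // j.
exact: integrable_cosB.
Qed.

(** Both sides expand into the same double sum over pairs [(i, j)], which reduces the limit to
    [cvg_logavg_corr] for each pair. *)
Lemma cvg_logavg_sqr_cmod (R : realType) (N : nat -> nat)
    (N_incr : forall s t, (s < t)%N -> (N s < N t)%N)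
    (A : set (int -> R[i])) (A_cstar : cstar_subalgebra A)
    (A_trans : translation_invariant A) (A_logmeans : admits_logmeans N A)
    (f : int -> R[i]) (Af : A f)
    (mu : {finite_measure set (measurableTypeR R) -> \bar R})
    (mu_spectral : spectral_measure N f mu)
    (I : Type) (r : seq I) (a : I -> R) (p : I -> nat) :
  (fun s => logavg (N s) (fun n =>
     cmod (\sum_(i <- r) real_complex R (a i) * f (n + (p i)%:Z)) ^+ 2))
    @ \oo -->
  Rintegral mu `[0, 1[%classic (sqnorm_expsum r a p).
Proof.
pose g i j (x : R) :=
  cos (2 * pi * ((p i)%:R * x)) * cos (2 * pi * ((p j)%:R * x)) +
  sin (2 * pi * ((p i)%:R * x)) * sin (2 * pi * ((p j)%:R * x)).
have ig i j : mu.-integrable `[0, 1[%classic (EFin \o g i j).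
  exact: integrable_cosB.
have -> : (fun s => logavg (N s) (fun n =>
     cmod (\sum_(i <- r) real_complex R (a i) * f (n + (p i)%:Z)) ^+ 2)) =
   (fun s => \sum_(i <- r) a i * \sum_(j <- r) a j * logavg (N s) (fun n =>
     complex.Re (f (n + (p i)%:Z) * (f (n + (p j)%:Z))^*%C))).
  apply/funext => s; under [LHS]eq_logavg do rewrite sqr_cmod_sum.
  by rewrite logavg_sum; apply: eq_bigr => i _; rewrite logavg_sum.
have -> : sqnorm_expsum r a p =
    (fun x => \sum_(i <- r) a i * \sum_(j <- r) a j * g i j x).
  by apply/funext => x; exact: sum_sqrD.
rewrite Rintegral_sumZ//; last by move=> i; exact: integrable_sumZ.
under eq_bigr do rewrite Rintegral_sumZ//.
apply: cvg_sumZ => i; apply: cvg_sumZ => j.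
exact: (cvg_logavg_corr _ _ N_incr _ A_cstar A_trans A_logmeans).
Qed.

(** * Zeros of the sine, cosine averages and rational points *)

Lemma sin_eq0_nat (R : realType) (y : R) :
  0 <= y -> sin y = 0 -> exists k : nat, y = pi *+ k.
Proof.
move=> y0 siny; have pi0 := pi_gt0 R.
have /andP[ky yk] := truncn_itv (divr_ge0 y0 (ltW pi0)).
(* Removing [k], the integer part of [y / pi], leaves [z] in [[0, pi)], where the sine vanishes only
   at 0. *)
set k := Num.truncn _ in ky yk; exists k; pose z := y - pi *+ k.
have yE : y = z + pi *+ k by rewrite subrK.
have z0 : 0 <= z by rewrite subr_ge0 -mulr_natl -ler_pdivlMr.
have zpi : z < pi.
  by rewrite ltrBlDr -mulrS -mulr_natl -ltr_pdivrMr.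
have sinz : sin z = 0.
  move: siny; rewrite yE (alternatingn (@sinDpi R)) => /eqP.
  by rewrite mulf_eq0 signr_eq0 => /eqP.
move: z0; rewrite le_eqVlt => /orP[/eqP z0|z0]; first by rewrite yE -z0 add0r.
by have := @sin_gt0_pi R z; rewrite z0 zpi sinz ltxx => /(_ isT).
Qed.

(** Dirichlet kernel: [2 * sin t * cos (2 * m * t)] is [sin ((2 * m + 1) * t) - sin ((2 * m - 1) *
    t)], and these differences telescope. *)
Lemma sin_mul_sum_cos (R : realType) (t : R) M :
  2 * sin t * (\sum_(1 <= m < M.+1) cos (m%:R * (2 * t))) =
  sin (M%:R * (2 * t) + t) - sin t.
Proof.
elim: M => [|M IH]; first by rewrite big_geq// mulr0 mul0r add0r subrr.
rewrite big_nat_recr//= mulrDr IH.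
have -> : M%:R * (2 * t) + t = M.+1%:R * (2 * t) - t by rewrite -natr1; ring.
by rewrite !sinD cosN sinN; ring.
Qed.

(** By the kernel identity the unnormalized sums are bounded by [1 / |sin t|] uniformly in [M]. *)
Lemma cvg_avg_cos (R : realType) (t : R) : sin t != 0 ->
  (fun M : nat => \sum_(1 <= m < M.+1) M%:R^-1 * cos (m%:R * (2 * t)))
    @ \oo --> (0 : R).
Proof.
move=> sint.
pose B := `|sin t|^-1.
have sint0 : 0 < `|sin t| by rewrite normr_gt0.
have bound M : `|\sum_(1 <= m < M.+1) M%:R^-1 * cos (m%:R * (2 * t))| <=
    M%:R^-1 * B.
  rewrite -mulr_sumr normrM ger0_norm ?invr_ge0//.
  rewrite ler_wpM2l ?invr_ge0// /B -[leRHS]mul1r ler_pdivlMr//.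
  rewrite mulrC -normrM -(@ler_pM2l _ 2)// -[X in X * _ <= _]ger0_norm//.
  rewrite -normrM mulrA sin_mul_sum_cos.
  by apply: le_trans (ler_normB _ _) _; rewrite mulr1 lerD ?sin_max.
have H0 : (fun M : nat => M%:R^-1 * B) @ \oo --> (0 : R).
  rewrite -(mul0r B); apply: cvgMr_tmp; apply/gtr0_cvgV0; last exact: cvgr_idn.
  by exists 1%N => // n /= n0; rewrite ltr0n.
apply: (@squeeze_cvgr _ _ _ _ (fun M => - (M%:R^-1 * B))
    (fun M => M%:R^-1 * B)) => //.
- by near=> M; rewrite -ler_norml.
- by rewrite -oppr0; apply: cvgN.
Unshelve. all: by end_near.
Qed.

(** A zero would make [q%:R * x] an integer, hence [x] rational. *)
Lemma sin_irrational_neq0 (R : realType) (q : nat) (x : R) :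
  (0 < q)%N -> 0 <= x -> irrational x -> sin (pi * (q%:R * x)) != 0.
Proof.
move=> q0 x0 xirr; apply/eqP => sinx; have pi0 := pi_gt0 R.
have [|k] := sin_eq0_nat _ _ _ sinx.
  by rewrite !mulr_ge0// ltW.
move=> sinE; have qxk : q%:R * x = k%:R.
  by apply: (mulfI (lt0r_neq0 pi0)); rewrite sinE mulr_natr.
apply: xirr; apply/rationalP; exists k%:Z, q.
by rewrite -pmulrn -qxk mulrC mulKf// pnatr_eq0 -lt0n.
Qed.

Lemma rational_natM (R : realType) (x : R) : 0 <= x -> rational x ->
  exists q k : nat, (0 < q)%N /\ q%:R * x = k%:R.
Proof.
move=> x0 /rationalP[a [b xE]].
(* [rationalP] allows the denominator 0; the quotient is then 0 by convention, so [x = 0]. *)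
have [b0|b0] := posnP b.
  by exists 1%N, 0%N; rewrite xE b0 invr0 !mulr0.
have bR : 0 < b%:R :> R by rewrite ltr0n.
exists b, `|a|%N; split=> //; rewrite xE mulrC divfK ?gt_eqF//.
move: x0; rewrite xE pmulr_lge0 ?invr_gt0// ler0z => a0.
by rewrite natr_absz ger0_norm.
Qed.

Lemma cos_2pi_nat (R : realType) (k : nat) : cos (2 * pi * k%:R) = 1 :> R.
Proof.
have -> : 2 * pi * k%:R = 0 + (pi *+ 2) *+ k :> R.
  by rewrite add0r -[(pi *+ 2) *+ k]mulr_natr -[pi *+ 2]mulr_natr; ring.
by rewrite (periodicn (@cosD2pi R)) cos0.
Qed.

Lemma sin_2pi_nat (R : realType) (k : nat) : sin (2 * pi * k%:R) = 0 :> R.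
Proof.
have -> : 2 * pi * k%:R = 0 + (pi *+ 2) *+ k :> R.
  by rewrite add0r -[(pi *+ 2) *+ k]mulr_natr -[pi *+ 2]mulr_natr; ring.
by rewrite (periodicn (@sinD2pi R)) sin0.
Qed.

(** * Null sets of rational and of irrational points *)

Lemma null_rational (R : realType)
    (mu : {measure set (measurableTypeR R) -> \bar R})
    (D : set (measurableTypeR R)) : measurable D ->
  (forall x, D x -> rational x -> mu [set x] = 0%E) ->
  mu (D `&` @rational R) = 0%E.
Proof.
move=> mD mu0.
(* Enumerates the rationals by their codes, so that the set is a countable union of pieces, each
   empty or a single null point. *)
pose F n : set (measurableTypeR R) :=
  if @unpickle rat n is Some c then D `&` [set ratr c] else set0.
have mF n : measurable (F n).
  rewrite /F; case: unpickle => [c|//]; apply: measurableI; first exact: mD.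
  exact: measurable_set1.
have FE : D `&` @rational R = \bigcup_n F n.
  apply/seteqP; split => [x [Dx [c _ cx]]|x [n _]].
    by exists (pickle c); [exact: I | rewrite /F pickleK; split].
  by rewrite /F; case: unpickle => [c [Dx xc]|[]]; split; last exists c.
have muF n : mu (F n) = 0%E.
  rewrite /F; case: unpickle => [c|]; last exact: measure0.
  have [Dc|Dc] := pselect (D (ratr c)).
    rewrite (_ : _ `&` _ = [set ratr c]); last first.
      by apply/seteqP; split => [x []//|x ->].
    by apply: mu0 => //; exists c.
  rewrite (_ : _ `&` _ = set0) ?measure0// -subset0 => x [Dx /= xc].
  by apply: Dc; rewrite -xc.
apply/negligibleP; rewrite FE.
  exact: bigcup_measurable.
apply: negligible_bigcup => n.
by apply/negligibleP; [exact: mF|exact: muF].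
Qed.

Lemma le_Rintegral_subset d (T : measurableType d) (R : realType)
    (mu : {measure set T -> \bar R}) (S D : set T) (g : T -> R) :
  measurable S -> measurable D -> S `<=` D -> (forall x, 0 <= g x) ->
  mu.-integrable D (EFin \o g) ->
  (\int[mu]_(x in S) (g x)%:E <= (Rintegral mu D g)%:E)%E.
Proof.
move=> mS mD SD g0 ig; rewrite fineK; last exact: integrable_fin_num.
apply: ge0_subset_integral => //.
- exact: measurable_int ig.
- by move=> x _; rewrite lee_fin.
Qed.

(** The averages [F M] over [m] have integral at most [e] over [S] and tend to 2 on [S]; dominated
    convergence gives [2 * mu S <= e]. *)
Lemma quasiperiodic_null_irrational (R : realType)
    (mu : {finite_measure set (measurableTypeR R) -> \bar R})
    (D S : set (measurableTypeR R)) :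
  measurable D -> measurable S -> S `<=` D ->
  (forall x, S x -> 0 <= x /\ irrational x) ->
  (forall e : R, 0 < e -> exists2 q, (0 < q)%N & forall m, (0 < m)%N ->
     Rintegral mu D (sqnorm_expsum [:: (1, (q * m)%N); (-1, 0%N)] fst snd)
       <= e) ->
  mu S = 0%E.
Proof.
move=> mD mS SD Sirr quasi.
suff le_mu (e : R) : 0 < e -> (mu S <= e%:E)%E.
  apply/eqP; rewrite eq_le measure_ge0 andbT.
  by apply/lee_addgt0Pr => e e0; rewrite add0e; exact: le_mu.
move=> e0; have [q q0 le_e] := quasi e e0.
pose g m : R -> R := sqnorm_expsum [:: (1, (q * m)%N); (-1, 0%N)] fst snd.
(* This is [|e(q m x) - 1|^2 = 2 - 2 cos(2 pi q m x)], arranged so that [cvg_avg_cos] applies with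
   [t = pi * (q%:R * x)]. *)
have gE m x : g m x = 2 + - 2 * cos (m%:R * (2 * (pi * (q%:R * x)))).
  rewrite /g /sqnorm_expsum !big_cons !big_nil /= mul0r !mulr0 cos0 sin0.
  set c := cos (2 * pi * _); set c' := cos _.
  have -> : c' = c by congr cos; rewrite natrM; ring.
  have := cos2Dsin2 (2 * pi * ((q * m)%:R * x)); rewrite -/c => cs.
  transitivity ((c - 1) ^+ 2 + sin (2 * pi * ((q * m)%:R * x)) ^+ 2).
    by ring.
  by rewrite -(addrK (c ^+ 2) (sin _ ^+ 2)) [sin _ ^+ 2 + _]addrC cs; ring.
have ig m : mu.-integrable D (EFin \o g m) by exact: integrable_sqnorm_expsum.
pose F M x := \sum_(1 <= m < M.+1) M%:R^-1 * g m x.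
have iF M : mu.-integrable D (EFin \o F M) by exact: integrable_sumZ.
have F0 M x : 0 <= F M x.
  by apply: sumr_ge0 => m _; rewrite mulr_ge0 ?invr_ge0// sqnorm_expsum_ge0.
(* The constant 4 bounds each [g m x] and serves as the dominating function. *)
have F4 M x : F M x <= 4.
  apply: (@le_trans _ _ (\sum_(1 <= m < M.+1) M%:R^-1 * 4)).
    apply: ler_sum => m _; rewrite ler_wpM2l ?invr_ge0// gE.
    have := cos_geN1 (m%:R * (2 * (pi * (q%:R * x)))); lra.
  rewrite sumr_const_nat subn1 /= -[(_ * _) *+ M]mulr_natr mulrAC.
  case: M => [|M]; first by rewrite invr0 !mul0r.
  by rewrite mulVf ?mul1r// pnatr_eq0.
have leF M : (\int[mu]_(x in S) (F M x)%:E <= e%:E)%E.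
  apply: le_trans (le_Rintegral_subset _ _ _ _ _ _ _ mS mD SD (F0 M) (iF M)) _.
  (* The range condition is kept in the sum because [le_e] requires [0 < m]. *)
  rewrite lee_fin Rintegral_sumZ// big_nat_cond.
  apply: (@le_trans _ _ (\sum_(1 <= m < M.+1 | (0 < m < M.+1)%N && true)
    M%:R^-1 * e)).
    apply: ler_sum => m /andP[/andP[m0 _] _].
    by rewrite ler_wpM2l ?invr_ge0// le_e.
  rewrite -big_nat_cond sumr_const_nat subn1 /= -[(_ * _) *+ M]mulr_natr mulrAC.
  case: M => [|M]; first by rewrite mulr0 mul0r ltW.
  by rewrite mulVf ?mul1r// pnatr_eq0.
have Fcvg x : S x -> (fun M => F M x) @ \oo --> (2 : R).
  move=> /Sirr[x0 xirr].
  have /cvg_avg_cos sum0 := sin_irrational_neq0 _ _ _ q0 x0 xirr.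
  pose c M := \sum_(1 <= m < M.+1) M%:R^-1 * cos (m%:R * (2 * (pi * (q%:R * x)))).
  (* The identity fails at [M = 0], where the empty average is 0 rather than 2. *)
  have FE : \forall M \near \oo, 2 + - 2 * c M = F M x.
    near=> M; rewrite /F; under eq_bigr do rewrite gE mulrDr.
    rewrite big_split /= sumr_const_nat subn1 /= -[(_ * _) *+ M]mulr_natr mulrAC.
    rewrite mulVf ?mul1r; last by rewrite pnatr_eq0 -lt0n; near: M; exists 1%N.
    by rewrite mulr_sumr; congr (_ + _); apply: eq_bigr => m _; ring.
  apply: cvg_trans (near_eq_cvg FE) _.
  suff : (fun M => 2 + - 2 * c M) @ \oo --> (2 + - 2 * 0 : R).
    by rewrite mulr0 addr0.
  by apply: cvgD; [exact: cvg_cst|exact: cvgMl_tmp].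
have int_cvg : (\int[mu]_(x in S) (F M x)%:E)%E @[M --> \oo] -->
    (\int[mu]_(x in S) 2%:E)%E.
  apply: (@dominated_cvg _ _ R mu S mS _ _ (fun=> 4%:E)).
  - move=> M; exact: measurable_int (integrableS mD mS SD (iF M)).
  - by move=> x Sx; apply: cvg_EFin; [exact: nearW|exact: Fcvg].
  - by [].
  - exact: finite_measure_integrable_cst.
  - by move=> M x _; rewrite lee_fin ger0_norm.
have : (\int[mu]_(x in S) 2%:E <= e%:E)%E.
  rewrite -(cvg_lim _ int_cvg)//; apply: lime_le; last exact: nearW.
  by apply/cvg_ex; eexists; exact: int_cvg.
rewrite integral_cst//; apply: le_trans.
by rewrite -[leLHS]mul1e lee_wpmul2r// lee_fin ler1n.
Unshelve. all: by end_near.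
Qed.

(** Every frequency [q * h] takes an integer value at [x], so all phases align and the integrand is
    1 there. Integrating over the single point bounds its mass for every [H > 0]. *)
Lemma aperiodic_null_point (R : realType)
    (mu : {finite_measure set (measurableTypeR R) -> \bar R})
    (D : set (measurableTypeR R)) (x : R) (q k : nat) :
  measurable D -> D x -> q%:R * x = k%:R ->
  (fun H : nat => Rintegral mu D
     (sqnorm_expsum (index_iota 1 H.+1) (fun=> H%:R^-1) (muln q)))
    @ \oo --> (0 : R) ->
  mu [set x] = 0%E.
Proof.
move=> mD Dx qxk cvg0; have mx := measurable_set1 x.
have sqnorm1 H : (0 < H)%N ->
    sqnorm_expsum (index_iota 1 H.+1) (fun=> H%:R^-1) (muln q) x = 1.
  move=> H0.
  have hx h : (q * h)%:R * x = (h * k)%:R by rewrite !natrM -qxk; ring.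
  rewrite /sqnorm_expsum.
  under eq_bigr do rewrite hx cos_2pi_nat.
  under [X in _ + X ^+ 2]eq_bigr do rewrite hx sin_2pi_nat mulr0.
  rewrite big1_eq sumr_const_nat subn1 /= mulr1 -[_ *+ H]mulr_natr.
  by rewrite mulVf ?pnatr_eq0 -?lt0n//; ring.
have le_int H : (0 < H)%N -> (mu [set x] <= (Rintegral mu D
    (sqnorm_expsum (index_iota 1 H.+1) (fun=> H%:R^-1%R) (muln q)))%:E)%E.
  move=> H0; have xD : [set x] `<=` D by move=> y ->.
  set g := sqnorm_expsum _ _ _.
  have ig : mu.-integrable D (EFin \o g) by exact: integrable_sqnorm_expsum.
  have g0 y : 0 <= g y by exact: sqnorm_expsum_ge0.
  apply: le_trans (le_Rintegral_subset _ _ _ mu _ _ g mx mD xD g0 ig).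
  rewrite (_ : integral _ _ _ = (\int[mu]_(y in [set x]) 1)%E).
    by rewrite integral_cst// mul1e.
  by apply: eq_integral => y; rewrite inE => ->; rewrite /g sqnorm1.
have fin_mu : mu [set x] \is a fin_num by exact: fin_num_measure.
apply/eqP; rewrite eq_le measure_ge0 andbT -(fineK fin_mu) lee_fin.
rewrite -(cvg_lim _ cvg0)//; apply: limr_ge; first by apply/cvg_ex; exists 0.
near=> H; rewrite -lee_fin (fineK fin_mu); apply: le_int.
by near: H; exists 1%N.
Unshelve. all: by end_near.
Qed.

(** * Specialization to the quasiperiodic and aperiodic averages *)

Theorem theorem5p1 (R : realType) (N : nat -> nat)
    (N_gt0 : forall s, (0 < N s)%N)
    (N_incr : forall s t, (s < t)%N -> (N s < N t)%N)
    (A : set (int -> R[i]))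
    (A_cstar : cstar_subalgebra A)
    (A_trans : translation_invariant A)
    (A_logmeans : admits_logmeans N A)
    (f : int -> R[i]) (Af : A f)
    (mu : {finite_measure set (measurableTypeR R) -> \bar R})
    (mu_spectral : spectral_measure N f mu) :
  (locally_quasiperiodic N f -> supported_on mu (@rational R)) /\
  (locally_aperiodic N f -> supported_on mu (@irrational R)).
Proof.
pose D : set (measurableTypeR R) := `[0, 1[%classic.
have mD : measurable D by exact: measurable_itv.
have D_ge0 (x : R) : D x -> 0 <= x by rewrite /D /= in_itv /= => /andP[].
(* Both local conditions concern means of this form: weights 1 and -1 at shifts [q * m] and 0 for
   quasiperiodicity, weights [1/H] at shifts [q * h] for aperiodicity. *)
have logmeanE (I : Type) (r : seq I) (a : I -> R) (p : I -> nat)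
    (g : int -> R) :
    (forall n, g n = cmod (\sum_(i <- r) real_complex R (a i)
       * f (n + (p i)%:Z)) ^+ 2) ->
    logmean N g = Rintegral mu D (sqnorm_expsum r a p).
  move=> /funext ->; apply: cvg_lim => //.
  exact: (cvg_logavg_sqr_cmod _ _ N_incr _ A_cstar A_trans A_logmeans).
split=> [quasi|aper].
- have mrat : measurable (D `\` @rational R).
    apply: measurableD => //; apply: countable_measurable => [t|].
      exact: measurable_set1.
    exact: sub_countable (card_image_le _ _) (countableP _).
  apply: (@quasiperiodic_null_irrational _ mu D _ mD mrat).
  + exact: subDsetl.
  + by move=> x [Dx xirr]; split=> //; exact: D_ge0.
  + move=> e e0; have [q q0 le_e] := quasi e e0; exists q => // m m0.
    rewrite -lee_fin; apply: le_trans le_e; apply: ereal_sup_ubound.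
    exists m => //; congr EFin; apply: logmeanE => n.
    rewrite !big_cons big_nil !addr0 (rmorphN1 (real_complex R)).
    by rewrite /= (rmorph1 (real_complex R)) mul1r mulN1r.
- rewrite /supported_on /irrational setDE setCK.
  apply: null_rational => // x Dx xrat.
  (* The denominator of the rational point [x] is the step [q] at which aperiodicity is applied. *)
  have [q [k [q0 qxk]]] := rational_natM _ _ (D_ge0 _ Dx) xrat.
  apply: (@aperiodic_null_point _ mu D x q k mD Dx qxk).
  rewrite (_ : (fun H => _) = fun H => logmean N (fun n =>
      cmod (unifavg H (fun h => f (n + q%:Z * h%:Z))) ^+ 2)).
    by apply: aper; rewrite eqz_nat -lt0n.
  apply/funext => H; apply/esym/logmeanE => n.
  rewrite /unifavg mulr_suml; congr (cmod _ ^+ 2); apply: eq_bigr => h _.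
  by rewrite mulrC PoszM fmorphV (rmorph_nat (real_complex R)).
Qed.
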